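(* Let $K\ge1$. For the class $\mathcal{A}_\infty$, and equally for the class of non-adaptive schedules, $$V_K:=\inf_{\text{methods}}\ \sup_{M\ \text{maximal monotone},\ d_0=1}\ \|r(y_K)\|\ =\ \frac1{K+1}.$$
   Context: The supremum is over real Hilbert spaces $H$, maximal monotone $M:H\rightrightarrows H$ and starting points $y_0\in H$ with $d_0=\operatorname{dist}(y_0,Z)=1$, where $Z=\{x:0\in Mx\}$. $J=(I+M)^{-1}$ is the resolvent and $r(y)=J(y)-y$. Class $\mathcal{A}_\infty$: a method which from $y_0$ performs at each iteration $k=0,1,2,\dots$ exactly one resolvent evaluation $x_k=J(v_k)$ at a query point $v_k$ in the affine hull of $\{y_0,x_0,\dots,x_{k-1}\}$ and then chooses $y_{k+1}$ in the affine hull of $\{y_0,x_0,\dots,x_k\}$, all (real, sum-one) coefficients being allowed to depend arbitrarily on everything observed so far (so $y_K$ uses $K$ resolvent evaluations). A non-adaptive schedule is such a method whose coefficients are fixed in advance, independently of the observed history; on a linear problem with resolvent $L$ it produces $y_K=Q_K(L)y_0$ with a polynomial $Q_K$ fixed in advance, $Q_K(1)=1$, $\deg Q_K\le K$. *)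

(* Defs.v *)
From HB Require Import structures.
From mathcomp Require Import all_boot all_order all_algebra.
From mathcomp Require Import all_classical all_reals all_analysis.

Set Implicit Arguments.
Unset Strict Implicit.
Unset Printing Implicit Defensive.

Import Order.TTheory GRing.Theory Num.Theory.
Import numFieldNormedType.Exports.

Local Open Scope classical_set_scope.
Local Open Scope ring_scope.

Record hilbertSpace (R : realType) := HilbertSpace {
  hilbert_sort :> completeNormedModType R;
  inner : {dot hilbert_sort for (@idfun R)};
  innerxx : forall x : hilbert_sort, inner x x = `|x| ^+ 2
}.

(* A set-valued operator [M : H => H] is a function [H -> set H]; [M x u] means
   that [u] belongs to [M x]. *)
Definition monotone (R : realType) (H : hilbertSpace R) (M : H -> set H) :=
  forall x y u v : H, M x u -> M y v -> 0 <= inner H (x - y) (u - v).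

Definition maximal_monotone (R : realType) (H : hilbertSpace R)
    (M : H -> set H) :=
  monotone M /\
  forall M' : H -> set H,
    monotone M' -> (forall x, M x `<=` M' x) -> forall x, M' x `<=` M x.

Definition zeros (R : realType) (H : hilbertSpace R) (M : H -> set H) : set H :=
  [set x | M x 0].

(* The distance to the empty set is [+oo]. *)
Definition dist (R : realType) (H : hilbertSpace R) (y : H) (Z : set H) :
    \bar R :=
  ereal_inf [set (`|y - z|)%:E | z in Z].

(* [(I + M)^-1 v] is the point [x] with [v \in x + M x]. For [M] maximal monotone
   it exists and is unique by Minty's theorem; [0] is a junk value that only
   occurs when there is no such [x]. *)
Definition resolvent (R : realType) (H : hilbertSpace R) (M : H -> set H)
    (v : H) : H :=
  xget 0 [set x | M x (v - x)].

Definition residual (R : realType) (H : hilbertSpace R) (M : H -> set H)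
    (y : H) : H :=
  resolvent M y - y.

(* The history at the start of iteration [k] is the tuple
   [(y_0, x_0, ..., x_{k-1})], of length [k.+1]. From it [query] returns the
   coefficients of [v_k], and [output] those of [y_k] (so those of [y_{k+1}]
   are chosen once [x_k] is known). The space [H] is known to the method, the
   operator only through the history. *)
Record method (R : realType) := Method {
  query : forall (H : hilbertSpace R) (k : nat), k.+1.-tuple H -> 'I_k.+1 -> R;
  output : forall (H : hilbertSpace R) (k : nat), k.+1.-tuple H -> 'I_k.+1 -> R;
  query_sum1 : forall (H : hilbertSpace R) (k : nat) (h : k.+1.-tuple H),
    \sum_i query h i = 1;
  output_sum1 : forall (H : hilbertSpace R) (k : nat) (h : k.+1.-tuple H),
    \sum_i output h i = 1
}.

Definition combination (R : realType) (H : hilbertSpace R) (n : nat)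
    (a : 'I_n -> R) (h : n.-tuple H) : H :=
  \sum_(i < n) a i *: tnth h i.

Fixpoint history (R : realType) (m : method R) (H : hilbertSpace R)
    (M : H -> set H) (y0 : H) (k : nat) : k.+1.-tuple H :=
  match k with
  | 0 => [tuple y0]
  | k'.+1 =>
      let h := history m M y0 k' in
      [tuple of rcons h (resolvent M (combination (query m h) h))]
  end.

Definition iterate (R : realType) (m : method R) (H : hilbertSpace R)
    (M : H -> set H) (y0 : H) (k : nat) : H :=
  combination (output m (history m M y0 k)) (history m M y0 k).

Definition nonadaptive (R : realType) (m : method R) : Prop :=
  exists a b : forall k : nat, 'I_k.+1 -> R,
    forall (H : hilbertSpace R) (k : nat) (h : k.+1.-tuple H) (i : 'I_k.+1),
      query m h i = a k i /\ output m h i = b k i.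

Definition worst_case (R : realType) (K : nat) (m : method R) : \bar R :=
  ereal_sup [set e | exists (H : hilbertSpace R) (M : H -> set H) (y0 : H),
    [/\ maximal_monotone M, dist y0 (zeros M) = 1%:E &
        e = (`|residual M (iterate m M y0 K)|)%:E]].

(* A class of methods is a [Prop]-valued predicate: [method R] is too large a
   type for [set (method R)]. *)
Definition minimax_value (R : realType) (K : nat) (C : method R -> Prop) :
    \bar R :=
  ereal_inf [set v | exists m : method R, C m /\ v = worst_case K m].

(* Main.v *)
(* Upper bound: the Halpern iteration [y_{k+1} = y_0/(k+2) + (k+1)/(k+2) T y_k]
   of the reflected resolvent [T = 2J - I] satisfies
   [k |r_k|^2 <= <r_k, y_k - y_0>] by induction, using only that [J] is firmly
   nonexpansive; together with [|r_k|^2 <= -<r_k, y_k - z>] for a zero [z] this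
   gives [(k+1) |r_k| <= |y_0 - z|]. That [J] is everywhere defined is Minty's
   theorem, obtained by minimising the Fitzpatrick function of [M] plus half the
   squared norm of [H x H].

   Lower bound: on [R^(K+1)] let [N] be the shift [e_i -> e_{i+1}] with
   [e_K -> -e_0], let [J = (I + N)/2] and [y_0 = (1, ..., 1)/sqrt (K+1)]. Then
   [y_0 - N y_0 = 2 e_0 / sqrt (K+1)]. With [K] evaluations of [J] the wrap-around
   of [N] is never reached, so affine combinations and [J] keep the sum of the
   coordinates of [y - N y]; by Cauchy-Schwarz [|y - N y| >= 2/(K+1)], however
   the coefficients are chosen. *)
From HB Require Import structures.
Require Import Defs.
From mathcomp Require Import all_boot all_order all_algebra.
From mathcomp Require Import all_classical all_reals all_analysis.
From mathcomp Require Import ring lra.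

Set Implicit Arguments.
Unset Strict Implicit.
Unset Printing Implicit Defensive.

Import Order.TTheory GRing.Theory Num.Theory.
Import numFieldNormedType.Exports.

Local Open Scope classical_set_scope.
Local Open Scope ring_scope.

(** * Euclidean space as a Hilbert space *)

Section Dot.
Variables (R : realFieldType) (V : lmodType R) (f : {dot V for (@idfun R)}).
Implicit Types (x y z : V) (a : R).

Lemma dotC x y : f x y = f y x.
Proof. by rewrite (@hermitian_subproof R V false (@idfun R) f) expr0 mul1r. Qed.

Lemma dotDl x y z : f (x + y) z = f x z + f y z.
Proof. exact: linearDl. Qed.

Lemma dotZl a x z : f (a *: x) z = a * f x z.
Proof. exact: linearZl_LR. Qed.

Lemma dotNl x z : f (- x) z = - f x z.
Proof. exact: linearNl. Qed.

Lemma dotDr x y z : f z (x + y) = f z x + f z y.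
Proof. by rewrite dotC dotDl !(dotC _ z). Qed.

Lemma dotZr a x z : f z (a *: x) = a * f z x.
Proof. by rewrite dotC dotZl (dotC _ z). Qed.

Lemma dotNr x z : f z (- x) = - f z x.
Proof. by rewrite dotC dotNl (dotC _ z). Qed.

Lemma dot0l x : f 0 x = 0.
Proof. exact: linear0l. Qed.

Lemma dotxx_ge0 x : 0 <= f x x.
Proof.
have [->|x0] := eqVneq x 0; first by rewrite dot0l.
by exact/ltW/neq0_dnorm_gt0.
Qed.

Lemma dotxx_eq0 x : f x x = 0 -> x = 0.
Proof.
apply: contra_eq => x0.
by rewrite gt_eqF //; exact: neq0_dnorm_gt0.
Qed.

Lemma dotDD x y : f (x + y) (x + y) = f x x + f x y *+ 2 + f y y.
Proof. by rewrite !(dotDl, dotDr) (dotC y x); ring. Qed.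

Lemma dot_CauchySchwarz x y : f x y ^+ 2 <= f x x * f y y.
Proof.
have [->|y0] := eqVneq y 0.
  by rewrite dotC !dot0l expr0n mulr0.
have yy : 0 < f y y by exact: neq0_dnorm_gt0.
have := dotxx_ge0 (f y y *: x - f x y *: y).
rewrite !(dotDl, dotDr, dotNl, dotNr, dotZl, dotZr) (dotC y x) => h.
rewrite -(ler_pM2l yy) -subr_ge0.
by apply: le_trans h _; rewrite le_eqVlt; apply/orP; left; apply/eqP; ring.
Qed.

End Dot.

Section Euclidean.
Variables (R : realType) (n : nat).

Definition euclidean := 'rV[R]_n.
HB.instance Definition _ := GRing.Lmodule.on euclidean.
Implicit Types x y : euclidean.

Definition euclid_dot x y : R := \sum_i x 0 i * y 0 i.

Lemma euclid_dot_bilinear : bilinear_for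
  (GRing.Scale.Law.clone _ _ *%R _) (GRing.Scale.Law.clone _ _ *%R _) euclid_dot.
Proof.
split=> [y|y] a u v /=; rewrite /euclid_dot mulr_sumr -big_split /=;
  by apply: eq_bigr => i _; rewrite !mxE; ring.
Qed.

HB.instance Definition _ := bilinear_isBilinear.Build R euclidean euclidean R
  _ _ euclid_dot euclid_dot_bilinear.

Lemma euclid_dotC x y : euclid_dot x y = (-1) ^+ false * @idfun R (euclid_dot y x).
Proof. by rewrite mul1r; apply: eq_bigr => i _; rewrite mulrC. Qed.

HB.instance Definition _ :=
  isHermitianSesquilinear.Build R euclidean false (@idfun R) euclid_dot euclid_dotC.

Lemma euclid_dot_gt0 x : x != 0 -> 0 < euclid_dot x x.
Proof.
move=> x0; rewrite lt_def sumr_ge0 ?andbT; last by move=> i _; rewrite -expr2 sqr_ge0.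
apply: contra x0; rewrite psumr_eq0; last by move=> i _; rewrite -expr2 sqr_ge0.
move=> /allP h; apply/eqP/rowP => i; rewrite mxE.
have := h i (mem_index_enum i); rewrite /= mulf_eq0 orbb; exact/eqP.
Qed.

HB.instance Definition _ := isDotProduct.Build R euclidean euclid_dot euclid_dot_gt0.

Definition euclid_norm x := Num.sqrt (euclid_dot x x).

Lemma ler_euclid_normD x y : euclid_norm (x + y) <= euclid_norm x + euclid_norm y.
Proof.
have sq z : euclid_norm z ^+ 2 = euclid_dot z z.
  by rewrite sqr_sqrtr// (dotxx_ge0 euclid_dot).
have xy : euclid_dot x y <= euclid_norm x * euclid_norm y.
  rewrite (le_trans (ler_norm _))// -(@ler_pXn2r _ 2) ?nnegrE ?mulr_ge0 ?sqrtr_ge0//.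
  rewrite exprMn !sq real_normK ?num_real//.
  exact: (dot_CauchySchwarz euclid_dot).
rewrite -(@ler_pXn2r _ 2) ?nnegrE ?addr_ge0 ?sqrtr_ge0//.
rewrite sqrrD !sq (dotDD euclid_dot) lerD2r lerD2l.
by rewrite lerMn2r xy.
Qed.

Lemma euclid_normZ (a : R) x : euclid_norm (a *: x) = `|a| * euclid_norm x.
Proof.
rewrite /euclid_norm (dotZl euclid_dot) (dotZr euclid_dot) mulrA -expr2.
by rewrite sqrtrM ?sqr_ge0// sqrtr_sqr.
Qed.

Lemma euclid_norm0_eq0 x : euclid_norm x = 0 -> x = 0.
Proof.
move=> /eqP; rewrite sqrtr_eq0 => h; apply: (@dotxx_eq0 _ _ euclid_dot).
by apply/le_anti; rewrite h (dotxx_ge0 euclid_dot).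
Qed.

HB.instance Definition _ := Lmodule_isNormed.Build R euclidean
  ler_euclid_normD euclid_normZ euclid_norm0_eq0.

Lemma euclid_normE x : `|x| = euclid_norm x.
Proof. by []. Qed.

Lemma euclid_coord_le x i : `|x 0 i| <= `|x|.
Proof.
rewrite euclid_normE -sqrtr_sqr ler_wsqrtr// /euclid_dot (bigD1 i)//= -expr2.
by rewrite lerDl sumr_ge0// => j _; rewrite -expr2 sqr_ge0.
Qed.

Lemma euclid_norm_le x (e : R) : 0 <= e -> (forall i, `|x 0 i| <= e) ->
  `|x| <= n%:R * e.
Proof.
move=> e0 h; rewrite euclid_normE -(@ler_pXn2r _ 2) ?nnegrE ?sqrtr_ge0 ?mulr_ge0//.
rewrite sqr_sqrtr ?(dotxx_ge0 euclid_dot)//.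
apply: (@le_trans _ _ (\sum_(i < n) e ^+ 2)).
  apply: ler_sum => i _; rewrite -expr2 -real_normK ?num_real//.
  by rewrite ler_pXn2r ?nnegrE.
rewrite sumr_const card_ord -[leLHS]mulr_natl exprMn ler_wpM2r ?sqr_ge0//.
by rewrite -natrX ler_nat; case: (n) => // k; rewrite leq_pmulr.
Qed.

Lemma euclid_complete (F : set_system euclidean) :
  ProperFilter F -> cauchy F -> cvg F.
Proof.
move=> FF /cauchy_ballP Fc.
have coordc i : cvg ((fun x : euclidean => x 0 i) @ F).
  have FFi : ProperFilter ((fun x : euclidean => x 0 i) @ F).
    exact: fmap_proper_filter.
  apply: R_complete; apply/cauchy_ballP => e e0.
  rewrite near_map2.
  apply: filterS (Fc e e0) => -[x y]; rewrite -!ball_normE /=.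
  rewrite /ball_ /= => h; apply: le_lt_trans h.
  by have := euclid_coord_le (x - y) i; rewrite !mxE.
pose l : euclidean := \row_i lim ((fun x : euclidean => x 0 i) @ F).
apply/cvg_ex; exists l; apply/cvgrPdist_le => e e0.
(* [n.+1] rather than [n] keeps the tolerance positive when [n = 0]. *)
have e'0 : 0 < e / n.+1%:R by rewrite divr_gt0.
have : \forall x \near F, forall i, `|l 0 i - (x : euclidean) 0 i| <= e / n.+1%:R.
  apply: filter_forall => i; rewrite mxE.
  by have /cvgrPdist_le/(_ _ e'0) := coordc i.
apply: filterS => x h.
apply: (@le_trans _ _ (n%:R * (e / n.+1%:R))).
  apply: euclid_norm_le => [|i]; first exact: ltW.
  by have := h i; rewrite !mxE.
rewrite mulrCA; apply: ler_piMr; first exact: ltW.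
by rewrite ler_pdivrMr// mul1r ler_nat.
Qed.

HB.instance Definition _ := Uniform_isComplete.Build euclidean euclid_complete.

Lemma euclid_dotxx x : euclid_dot x x = `|x| ^+ 2.
Proof. by rewrite euclid_normE sqr_sqrtr// (dotxx_ge0 euclid_dot). Qed.

Definition euclidean_hilbert : hilbertSpace R :=
  HilbertSpace (hilbert_sort := euclidean) (inner := euclid_dot) euclid_dotxx.

End Euclidean.

(** * Minty's theorem *)

Section Hilbert.
Variables (R : realType) (H : hilbertSpace R).
Local Notation "''[' x , y ]" := (inner H x y) : ring_scope.

Lemma inner_polarization (x y : H) :
  '[x, y] = 4^-1 * (`|x + y| ^+ 2 - `|x - y| ^+ 2).
Proof.
rewrite -!innerxx !(dotDl, dotDr, dotNl, dotNr) (dotC _ y x).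
by field.
Qed.

Lemma cvg_inner (x y : H^nat) (a b : H) :
  x @ \oo --> a -> y @ \oo --> b -> ('[x n, y n] @[n --> \oo]) --> '[a, b].
Proof.
move=> xa yb; rewrite inner_polarization.
under eq_fun do rewrite inner_polarization.
apply: cvgM; first exact: cvg_cst.
apply: cvgB; rewrite expr2; under eq_fun do rewrite expr2; apply: cvgM;
  apply: cvg_norm; (exact: cvgD || exact: cvgB).
Qed.

(** The kind of bound that strong convexity gives for a minimising sequence with gaps [1/(n+1)]. *)
Lemma cvg_of_sqr_dist_le (x : H^nat) (c : R) :
  (forall p q, `|x p - x q| ^+ 2 <= c * (p.+1%:R^-1 + q.+1%:R^-1)) ->
  cvgn x.
Proof.
move=> h; have c0 : 0 <= c.
  have := le_trans (sqr_ge0 _) (h 0 0).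
  by rewrite pmulr_lge0 // addr_gt0 ?invr_gt0.
apply: cauchy_cvg; apply/cauchy_ballP => e e0.
have c1 : 0 < 2 * (c + 1) by lra.
have d0 : 0 < e ^+ 2 / (2 * (c + 1)) by rewrite divr_gt0 ?exprn_gt0.
have [N _ hN] := near_infty_natSinv_lt (PosNum d0).
rewrite near_map2; exists ([set n | N <= n]%N, [set n | N <= n]%N) => /=.
  by split; exists N.
case=> p q /= [Np Nq]; rewrite -ball_normE /ball_ /=.
rewrite -(@ltr_pXn2r _ 2) ?nnegrE ?(ltW e0)//.
apply: le_lt_trans (h p q) _.
have := hN p Np; have := hN q Nq => /=.
rewrite !ltr_pdivlMr// => hq hp.
have : 0 < p.+1%:R^-1 :> R by rewrite invr_gt0.
have : 0 < q.+1%:R^-1 :> R by rewrite invr_gt0.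
move: hp hq; set P := p.+1%:R^-1; set Q := q.+1%:R^-1; nra.
Qed.

End Hilbert.

Section Minty.
Variables (R : realType) (H : hilbertSpace R).
Local Notation "''[' x , y ]" := (inner H x y) : ring_scope.

(** Adjoining the pair [(x, u)] to the graph keeps it monotone, so by maximality it was already
    there. *)
Lemma maximal_monotone_mem (M : H -> set H) (x u : H) : maximal_monotone M ->
  (forall y v, M y v -> 0 <= '[x - y, u - v]) -> M x u.
Proof.
move=> [mono maxi] h.
apply: (maxi (fun a => M a `|` [set b | a = x /\ b = u])); last by right.
  move=> a b c d [ac|[-> ->]] [bd|[-> ->]].
  - exact: mono.
  - rewrite -(opprB x a) -(opprB u c) dotNl dotNr opprK; exact: h.
  - exact: h.
  - by rewrite subrr dot0l.
by move=> a b Mab; left.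
Qed.

Section Fitzpatrick.
Variables (M : H -> set H) (Mmax : maximal_monotone M).

(* The epigraph of the Fitzpatrick function of [M]; the function itself may take
   the value [+oo]. *)
Definition fitzpatrick_epigraph (x u : H) (t : R) :=
  forall y v, M y v -> '[x, v] + '[y, u] - '[y, v] <= t.

(** If [t < '[x, u]], the defining inequalities make [(x, u)] monotonically related to the whole
    graph, hence a member of it; testing at [(x, u)] itself is then contradictory. *)
Lemma fitzpatrick_ge (x u : H) (t : R) : fitzpatrick_epigraph x u t -> '[x, u] <= t.
Proof.
move=> h; rewrite leNgt; apply/negP => lt.
suff Mxu : M x u by have := h x u Mxu; lra.
apply: maximal_monotone_mem => // y v Myv; have := h y v Myv.
by rewrite !(dotDl, dotDr, dotNl, dotNr); lra.
Qed.

Lemma fitzpatrick_graph (y v : H) : M y v -> fitzpatrick_epigraph y v '[y, v].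
Proof.
move=> Myv z w Mzw; have := Mmax.1 _ _ _ _ Myv Mzw.
by rewrite !(dotDl, dotDr, dotNl, dotNr); lra.
Qed.

(** Each defining inequality is affine in [(x, u, t)], so the epigraph is an intersection of
    half-spaces. *)
Lemma fitzpatrick_convex (a : R) (x u x' u' : H) (t t' : R) : 0 <= a <= 1 ->
  fitzpatrick_epigraph x u t -> fitzpatrick_epigraph x' u' t' ->
  fitzpatrick_epigraph ((1 - a) *: x + a *: x') ((1 - a) *: u + a *: u')
    ((1 - a) * t + a * t').
Proof.
move=> /andP[a0 a1] h h' y v Myv.
have := h y v Myv; have := h' y v Myv.
by rewrite !(dotDl, dotDr, dotZl, dotZr); nra.
Qed.

Definition fitzpatrick_energy (x u : H) (t : R) : R :=
  t + ('[x, x] + '[u, u]) / 2.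

Lemma fitzpatrick_energy_ge0 (x u : H) (t : R) :
  fitzpatrick_epigraph x u t -> 0 <= fitzpatrick_energy x u t.
Proof.
move=> /fitzpatrick_ge h; have := dotxx_ge0 (inner H) (x + u).
rewrite /fitzpatrick_energy dotDD mulr2n; lra.
Qed.

(** Near-minimisers of the energy form a Cauchy sequence. First-order optimality is proved
    approximately along it and then passed to the limit [(x0, u0)], in place of lower semicontinuity
    of the Fitzpatrick function. *)
Lemma minty0 : exists x, M x (- x).
Proof.
(* An empty graph would satisfy [maximal_monotone_mem] vacuously and so contain [(0, 0)]. *)
have [y0 [v0 Mv0]] : exists y v, M y v.
  apply/not_existsP => h.
  have h' y v : ~ M y v by move=> Myv; apply: (h y); exists v.
  by apply: (h' 0 0); apply: maximal_monotone_mem => // y v /h'.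
pose S := [set e | exists x u t, fitzpatrick_epigraph x u t /\
                                 e = fitzpatrick_energy x u t].
have Sinf : has_inf S.
  split; first by exists (fitzpatrick_energy y0 v0 '[y0, v0]), y0, v0, '[y0, v0];
    split=> //; exact: fitzpatrick_graph.
  by exists 0 => _ [x [u [t [h ->]]]]; exact: fitzpatrick_energy_ge0.
have Sge x u t : fitzpatrick_epigraph x u t -> inf S <= fitzpatrick_energy x u t.
  by move=> h; apply: ge_inf; [exact: Sinf.2 | exists x, u, t].
have /choice[p hp] : forall n, exists p : H * H * R,
    fitzpatrick_epigraph p.1.1 p.1.2 p.2 /\
    fitzpatrick_energy p.1.1 p.1.2 p.2 < inf S + n.+1%:R^-1.
  move=> n; have n0 : 0 < n.+1%:R^-1 :> R by rewrite invr_gt0.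
  have [_ [x [u [t [h ->]]]] lt] := inf_adherent n0 Sinf.
  by exists (x, u, t).
pose x n := (p n).1.1; pose u n := (p n).1.2; pose t n := (p n).2.
have pC n : fitzpatrick_epigraph (x n) (u n) (t n) by case: (hp n).
have pE n : fitzpatrick_energy (x n) (u n) (t n) < inf S + n.+1%:R^-1.
  by case: (hp n).
(* Parallelogram identity: the energy at the midpoint is the average energy minus an eighth of the
   left side, yet at least [inf S]. *)
have close i j : '[x i - x j, x i - x j] + '[u i - u j, u i - u j] <=
    4 * (i.+1%:R^-1 + j.+1%:R^-1).
  have h01 : 0 <= (2^-1 : R) <= 1 by lra.
  have := Sge _ _ _ (fitzpatrick_convex h01 (pC i) (pC j)).
  have := pE i; have := pE j; rewrite /fitzpatrick_energy.
  rewrite !(dotDl, dotDr, dotZl, dotZr, dotNl, dotNr).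
  rewrite (dotC _ (x j) (x i)) (dotC _ (u j) (u i)).
  set a := i.+1%:R^-1; set b := j.+1%:R^-1. lra.
have /cvg_ex[x0 xx0] : cvgn x.
  apply: (@cvg_of_sqr_dist_le _ _ _ 4) => i j; apply: le_trans (close i j).
  by rewrite -innerxx lerDl dotxx_ge0.
have /cvg_ex[u0 uu0] : cvgn u.
  apply: (@cvg_of_sqr_dist_le _ _ _ 4) => i j; apply: le_trans (close i j).
  by rewrite -innerxx lerDr dotxx_ge0.
(* The directional derivative of the energy towards [(y, v)] is nonnegative; its term [t] is bounded
   below by [fitzpatrick_ge]. *)
have optimal y v : M y v -> '[x0 + u0, x0 + u0] <= '[y + u0, v + x0].
  move=> Myv.
  (* [G] is the slack of the claim and [D] the squared distance to [(y, v)], which bounds the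
     second-order term and disappears as [s] tends to 0. *)
  pose G a b := '[y + b, v + a] - '[a + b, a + b].
  pose D a b := '[y - a, y - a] + '[v - b, v - b].
  have D0 : 0 <= D x0 u0 by rewrite addr_ge0 ?dotxx_ge0.
  suff key s : 0 < s <= 1 -> 0 <= G x0 u0 + s * D x0 u0.
    rewrite -subr_ge0 -/(G x0 u0); apply/ler_addgt0Pr => e e0.
    have D1 : 0 < D x0 u0 + 1 by lra.
    pose s := Num.min 1 (e / (D x0 u0 + 1)).
    have s0 : 0 < s <= 1 by rewrite /s lt_min ltr01 divr_gt0//= ge_min lexx.
    apply: le_trans (key s s0) _; rewrite lerD2l.
    have : s <= e / (D x0 u0 + 1) by rewrite /s ge_min lexx orbT.
    rewrite ler_pdivlMr//; have /andP[] := s0; nra.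
  move=> /andP[s0 s1].
  (* Compare [p n] with the point at fraction [s] of the way to [(y, v)]. *)
  have approx n : - (n.+1%:R^-1 / s) <= G (x n) (u n) + s * D (x n) (u n).
    have h01 : 0 <= s <= 1 by rewrite ltW.
    have := Sge _ _ _ (fitzpatrick_convex h01 (pC n) (fitzpatrick_graph Myv)).
    have := pE n; have := ler_wpM2l (ltW s0) (fitzpatrick_ge (pC n)).
    have : 0 <= s ^+ 2 * D (x n) (u n).
      by rewrite mulr_ge0 ?sqr_ge0 ?addr_ge0 ?dotxx_ge0.
    rewrite -mulNr ler_pdivrMr// /G /D /fitzpatrick_energy; set iv := n.+1%:R^-1.
    rewrite !(dotDl, dotDr, dotZl, dotZr, dotNl, dotNr).
    rewrite (dotC _ y (x n)) (dotC _ v (u n)) (dotC _ (u n) (x n)).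
    by lra.
  have lhs : (- (n.+1%:R^-1 / s)) @[n --> \oo] --> (0 : R).
    rewrite -oppr0; apply: cvgN; rewrite -(mul0r s^-1); apply: cvgMl.
    exact: cvg_harmonic.
  apply: ler_cvg_to lhs _ _; last by near=> n; exact: approx.
  apply: cvgD.
    by apply: cvgB; apply: cvg_inner; apply: cvgD => //; exact: cvg_cst.
  apply: cvgMr; apply: cvgD; apply: cvg_inner; apply: cvgB => //; exact: cvg_cst.
(* The right side of [optimal] equals ['[- u0 - y, - x0 - v]]. *)
have Mux : M (- u0) (- x0).
  apply: maximal_monotone_mem => // y v Myv.
  rewrite -opprD -[- x0 - v]opprD dotNl dotNr opprK (addrC u0) (addrC x0).
  exact: le_trans (dotxx_ge0 _ _) (optimal y v Myv).
(* At the graph point [(- u0, - x0)] the right side of [optimal] vanishes. *)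
have xu : x0 + u0 = 0.
  apply: (@dotxx_eq0 _ _ (inner H)); apply/le_anti; rewrite dotxx_ge0 andbT.
  by have := optimal _ _ Mux; rewrite addNr dot0l.
by exists x0; move: Mux; rewrite -(addr0_eq xu) opprK.
Unshelve. all: by end_near. Qed.
End Fitzpatrick.

(** Translating the values of [M] by [- v] preserves maximal monotonicity and reduces to
    [minty0]. *)
Lemma minty (M : H -> set H) (v : H) : maximal_monotone M ->
  exists x, M x (v - x).
Proof.
move=> [mono maxi].
have [x] : exists x, M x (- x + v); last by rewrite addrC; exists x.
apply: (@minty0 (fun x u => M x (u + v))); split=> [x y a b Ma Mb|M' mono' sub x u].
  by have := mono _ _ _ _ Ma Mb; rewrite opprD addrACA subrr addr0.
move=> M'xu; apply: (maxi (fun x u => M' x (u - v))); last by rewrite addrK.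
- by move=> y z a b /mono'/[apply]; rewrite opprB addrA subrK.
- by move=> y a May; apply: sub; rewrite subrK.
Qed.

Lemma resolventP (M : H -> set H) (v : H) : maximal_monotone M ->
  M (resolvent M v) (v - resolvent M v).
Proof.
by move=> /(minty v)[x Mx]; exact: (xgetI 0 (P := [set x | M x (v - x)]) Mx).
Qed.

(** Monotonicity between the graph points over the two resolvent values, rewritten for residuals. *)
Lemma resolvent_firmly_nonexpansive (M : H -> set H) (v w : H) :
  maximal_monotone M ->
  `|residual M v - residual M w| ^+ 2 <= - '[residual M v - residual M w, v - w].
Proof.
move=> Mmax; have := Mmax.1 _ _ _ _ (resolventP v Mmax) (resolventP w Mmax).
rewrite /residual -innerxx; set a := resolvent M v; set b := resolvent M w.
rewrite !(dotDl, dotDr, dotNl, dotNr).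
rewrite (dotC _ v w) (dotC _ b a) (dotC _ v a) (dotC _ v b) (dotC _ w a) (dotC _ w b).
by lra.
Qed.

Lemma residual_zero (M : H -> set H) (z : H) : maximal_monotone M ->
  zeros M z -> residual M z = 0.
Proof.
move=> Mmax Mz; have := Mmax.1 _ _ _ _ (resolventP z Mmax) Mz.
rewrite /residual subr0 -(opprB (resolvent M z) z) dotNr oppr_ge0 => h.
by apply: (@dotxx_eq0 _ _ (inner H)); apply/le_anti; rewrite dotxx_ge0 h.
Qed.
End Minty.

(** * The Halpern iteration *)

Section Halpern.
Variable R : realType.

(** Coefficients of [y_k] in the history: index 0 is [y_0] and index [k] is [x_{k-1}], so the last
    factor encodes [2 x_{k-1} - y_{k-1}]. Taking [i] in [nat] avoids ordinal casts in the
    recursion. *)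
Fixpoint halpern_coef (k i : nat) : R :=
  match k with
  | 0 => (i == 0)%:R
  | k'.+1 => k'.+2%:R^-1 * (i == 0)%:R +
      (1 - k'.+2%:R^-1) * ((i == k)%:R *+ 2 - halpern_coef k' i)
  end.

Lemma halpern_coef_gt (k i : nat) : (k < i)%N -> halpern_coef k i = 0.
Proof.
elim: k => [|k IH] /= ki; first by rewrite gtn_eqF.
rewrite gtn_eqF ?(leq_ltn_trans _ ki)// gtn_eqF// IH ?(ltnW ki)//.
by rewrite mulr0 mul0rn subrr mulr0 addr0.
Qed.

Lemma halpern_coef_sum1 (k : nat) : \sum_(i < k.+1) halpern_coef k i = 1.
Proof.
elim: k => [|k IH]; first by rewrite big_ord_recl big_ord0 addr0.
rewrite /= big_split /= -!mulr_sumr sumrB sumrMnl.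
rewrite [X in _ *+ _ - X]big_ord_recr /= IH halpern_coef_gt// addr0.
have -> : \sum_(i < k.+2) (i == 0%N :> nat)%:R = 1 :> R.
  by rewrite big_ord_recl big1 ?addr0.
have -> : \sum_(i < k.+2) (i == k.+1 :> nat)%:R = 1 :> R.
  by rewrite big_ord_recr /= eqxx big1 ?add0r// => i _; rewrite ltn_eqF.
by ring.
Qed.

Definition halpern : method R :=
  @Method R (fun _ k _ i => halpern_coef k i) (fun _ k _ i => halpern_coef k i)
    (fun _ k _ => halpern_coef_sum1 k) (fun _ k _ => halpern_coef_sum1 k).

Lemma halpern_nonadaptive : nonadaptive halpern.
Proof. by exists (fun k i => halpern_coef k i), (fun k i => halpern_coef k i). Qed.

Section Rate.
Variables (H : hilbertSpace R) (M : H -> set H) (Mmax : maximal_monotone M).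
Variable y0 : H.
Local Notation "''[' x , y ]" := (inner H x y) : ring_scope.
Local Notation y := (iterate halpern M y0).
Local Notation r k := (residual M (y k)).

Lemma history_head (m : method R) (k : nat) : tnth (history m M y0 k) ord0 = y0.
Proof.
rewrite (tnth_nth 0); elim: k => [|k IH] //=.
by rewrite nth_rcons size_tuple.
Qed.

Lemma halpern_iterate0 : y 0 = y0.
Proof. by rewrite /iterate /combination big_ord_recl big_ord0 addr0 /= scale1r. Qed.

(** The three terms of [halpern_coef] yield the anchor, the newest history entry and [y k]; the
    coefficient of [y k] at the newest entry is zero. *)
Lemma halpern_iterateS (k : nat) :
  y k.+1 = k.+2%:R^-1 *: y0 + (1 - k.+2%:R^-1) *: (y k + r k *+ 2).
Proof.
have -> : y k + r k *+ 2 = resolvent M (y k) *+ 2 - y k.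
  rewrite /residual; set a := resolvent _ _.
  by rewrite mulrnBl addrCA -opprB mulr2n addrK.
rewrite {1}/iterate /combination.
under eq_bigr => i _ do rewrite [output _ _ _]/= scalerDl.
rewrite big_split /=; congr (_ + _).
  rewrite big_ord_recl /= big1 ?addr0 ?mulr1; last by move=> i _; rewrite mulr0 scale0r.
  by rewrite (history_head _ k.+1).
under eq_bigr => i _ do rewrite -scalerA.
rewrite -scaler_sumr; congr (_ *: _).
under eq_bigr => i _ do rewrite scalerBl.
rewrite sumrB; congr (_ - _).
  rewrite big_ord_recr big1 /= => [|i _]; last by rewrite ltn_eqF// mul0rn scale0r.
  rewrite add0r eqxx (tnth_nth 0) /= nth_rcons size_tuple ltnn eqxx.
  by rewrite scaler_nat.
rewrite big_ord_recr /= halpern_coef_gt// scale0r addr0; apply: eq_bigr => i _.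
by rewrite !(tnth_nth 0) /= nth_rcons size_tuple ltn_ord.
Qed.

Lemma halpern_lyapunov (k : nat) :
  k%:R * '[r k, r k] <= '[r k, y k - y0].
Proof.
elim: k => [|k IH]; first by rewrite halpern_iterate0 subrr mul0r dotC dot0l.
have := resolvent_firmly_nonexpansive (y k.+1) (y k) Mmax.
rewrite -innerxx.
move: (r k.+1) => r'; rewrite halpern_iterateS.
move: IH; move: (r k) => s; move: (y k) => x IH.
have k2 : k.+2%:R != 0 :> R by rewrite pnatr_eq0.
have kE : k%:R = k.+2%:R - 2 :> R by rewrite -(natrB _ (isT : 2 <= k.+2)%N) subn2.
have k1E : k.+1%:R = k.+2%:R * (1 - k.+2%:R^-1) :> R.
  by rewrite mulrBr mulr1 mulfV// -(natrB _ (isT : 1 <= k.+2)%N) subn1.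
have b0 : 0 < k.+2%:R^-1 :> R by rewrite invr_gt0 ltr0n.
have b1 : k.+2%:R^-1 <= 1 :> R by rewrite invf_le1 ?ler1n ?ltr0n.
(* The hypothesis divided by [k+2], using [k/(k+2) = 1 - 2/(k+2)]. *)
have {}IH : (1 - k.+2%:R^-1 *+ 2) * '[s, s] <= k.+2%:R^-1 * '[s, x - y0].
  have := ler_wpM2l (ltW b0) IH.
  by rewrite kE mulrA mulrBr mulVf// mulr_natr.
have k1_ge0 : 0 <= k.+1%:R :> R by [].
have cb : k.+2%:R * k.+2%:R^-1 = 1 :> R by rewrite mulfV.
move: k1_ge0; rewrite k1E; move: k.+2%:R k.+2%:R^-1 cb IH {k2 b0 b1 kE k1E} => c b cb IH.
move=> k1_ge0 fne.
(* Adding [fne] and [IH] cancels every term in ['[s, s]] and ['[s, x - y0]]. *)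
have key : '[r', r'] <= b * '[r', x - y0 + s *+ 2].
  move: fne IH; rewrite !mulr2n !(dotDl, dotDr, dotZl, dotZr, dotNl, dotNr).
  by rewrite (dotC _ s r'); lra.
(* The left vector is [(1 - b) *: (x - y0 + s *+ 2)], and [c * b = 1]. *)
have -> : '[r', b *: y0 + (1 - b) *: (x + s *+ 2) - y0] =
    (c * (1 - b)) * (b * '[r', x - y0 + s *+ 2]).
  rewrite mulrA (mulrAC c) cb mul1r.
  by rewrite !mulr2n !(dotDl, dotDr, dotZl, dotZr, dotNl, dotNr); ring.
exact: ler_wpM2l.
Qed.

Lemma halpern_rate (k : nat) : dist y0 (zeros M) = 1%:E -> `|r k| <= k.+1%:R^-1.
Proof.
move=> d1; have k1 : 0 < k.+1%:R :> R by [].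
rewrite -[leRHS]mul1r ler_pdivlMr// -lee_fin -d1.
apply: le_ereal_inf_tmp => _ [z Mz <-]; rewrite lee_fin.
have := resolvent_firmly_nonexpansive (y k) z Mmax.
rewrite (residual_zero Mmax Mz) subr0 => fne.
have lyap := halpern_lyapunov k.
have CS := dot_CauchySchwarz (inner H) (r k) (z - y0).
have [->|r0] := eqVneq `|r k| 0; first by rewrite mul0r.
have rpos : 0 < `|r k| by rewrite lt_def r0 normr_ge0.
rewrite -(ler_pM2l rpos) mulrA.
(* Adding [fne] to [lyap] eliminates [y k] and raises the factor from [k] to [k+1]. *)
apply: (@le_trans _ _ '[r k, z - y0]).
  move: fne lyap; rewrite -expr2 -!innerxx -natr1 !(dotDl, dotDr, dotNl, dotNr); lra.
rewrite (le_trans (ler_norm _))// -(@ler_pXn2r _ 2) ?nnegrE ?mulr_ge0//.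
by rewrite real_normK ?num_real// exprMn (distrC y0) -!innerxx.
Qed.

End Rate.
End Halpern.

(** * The resisting operator *)

Section OperatorOfResolvent.
Variables (R : realType) (H : hilbertSpace R) (L : H -> H).
Hypothesis Lfne :
  forall v w, 0 <= inner H (L v - L w) ((v - L v) - (w - L w)).

(** This is the inverse of [L] minus the identity, set-valued since [L] may fail to be injective. *)
Definition operator_of (x : H) : set H := [set u | x = L (x + u)].

(** A pair [(x, u)] of a monotone extension is compared with the graph point having the same sum
    [x + u]: the two differences are opposite, so they vanish. *)
Lemma operator_of_maximal : maximal_monotone operator_of.
Proof.
split=> [x y u v xE yE|M' mono sub x u M'xu].
  by have := Lfne (x + u) (y + v); rewrite -xE -yE (addrC x u) (addrC y v) !addrK.
have LM : operator_of (L (x + u)) (x + u - L (x + u)).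
  by rewrite /operator_of /= subrKC.
have := mono _ _ _ _ M'xu (sub _ _ LM).
have -> : u - (x + u - L (x + u)) = - (x - L (x + u)).
  by move: (L _) => l; rewrite !opprB addrCA opprD (addrC (- x)) addNKr.
rewrite dotNr oppr_ge0 => le0; apply/eqP; rewrite -subr_eq0; apply/eqP.
by apply: (@dotxx_eq0 _ _ (inner H)); apply/le_anti; rewrite dotxx_ge0 le0.
Qed.

Lemma resolvent_operator_of (v : H) : resolvent operator_of v = L v.
Proof.
rewrite /resolvent; have -> : [set x | operator_of x (v - x)] = [set L v].
  by apply/seteqP; split=> x /=; rewrite /operator_of /= addrC subrK.
by case: xgetP => [x _|/(_ (L v))]; last by case.
Qed.

Lemma zeros_operator_of : zeros operator_of = [set x | x = L x].
Proof. by apply/seteqP; split=> x /=; rewrite /zeros /operator_of /= addr0. Qed.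

End OperatorOfResolvent.

(** * The signed cyclic shift and the lower bound *)

Section LowerBound.
Variables (R : realType) (K : nat).
Local Notation E := (euclidean R K.+1).
Implicit Types x y z : E.

Definition antishift x : E :=
  \row_i if unlift ord0 i is Some j then x 0 (widen_ord (leqnSn K) j)
         else - x 0 ord_max.

Lemma antishift0 x : antishift x 0 ord0 = - x 0 ord_max.
Proof. by rewrite mxE unlift_none. Qed.

Lemma antishift_lift x j : antishift x 0 (lift ord0 j) = x 0 (widen_ord (leqnSn K) j).
Proof. by rewrite mxE liftK. Qed.

Lemma antishift_linear : linear antishift.
Proof.
move=> a x y; apply/rowP => i; rewrite !mxE; case: unliftP => [j _|_].
  by rewrite !mxE.
by rewrite opprD mulrN.
Qed.

HB.instance Definition _ := GRing.isLinear.Build R E E *:%R antishift antishift_linear.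

Lemma antishift_isometry x : euclid_dot (antishift x) (antishift x) = euclid_dot x x.
Proof.
rewrite /euclid_dot big_ord_recl [RHS]big_ord_recr /= antishift0 mulrNN addrC.
by congr (_ + _); apply: eq_bigr => i _; rewrite antishift_lift.
Qed.

(** All coordinates of a fixed point agree, and the sign at the wrap-around makes their common value
    its own opposite. *)
Lemma antishift_fixed x : x = antishift x -> x = 0.
Proof.
move=> xN; have h k (lt : (k < K.+1)%N) : x 0 (Ordinal lt) = x 0 ord0.
  elim: k lt => [|k IH] lt; first by congr (x 0 _); exact: val_inj.
  have -> : Ordinal lt = lift ord0 (Ordinal (lt : k < K)%N) by exact: val_inj.
  rewrite [in LHS]xN antishift_lift -(IH (ltnW lt)); congr (x 0 _); exact: val_inj.
have x0 : x 0 ord0 = 0.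
  have : x 0 ord_max = x 0 ord0 by rewrite -(h K (ltnSn K)); congr (x 0 _); exact: val_inj.
  by have := antishift0 x; rewrite -xN => ->; lra.
by apply/rowP => -[k lt]; rewrite h x0 mxE.
Qed.

Definition half_antishift x : E := 2^-1 *: (x + antishift x).

(** With [d = v - w], the inner product is a quarter of the difference of the squared norms of [d]
    and [antishift d], which is zero by isometry. *)
Lemma half_antishift_fne (v w : euclidean_hilbert R K.+1) :
  0 <= inner (euclidean_hilbert R K.+1) (half_antishift v - half_antishift w)
    ((v - half_antishift v) - (w - half_antishift w)).
Proof.
have -> : v - half_antishift v - (w - half_antishift w) =
    v - w - (half_antishift v - half_antishift w).
  by rewrite [- (w - _)]opprD addrACA -opprD.
have -> : half_antishift v - half_antishift w = half_antishift (v - w).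
  by rewrite /half_antishift -scalerBr [antishift (v - w)]linearB opprD addrACA.
move: (v - w) => d; rewrite /half_antishift.
have iso : inner (euclidean_hilbert R K.+1) (antishift d) (antishift d) =
    inner (euclidean_hilbert R K.+1) d d := antishift_isometry d.
rewrite !(dotDl, dotDr, dotZl, dotZr, dotNl, dotNr) (dotC _ (antishift d) d).
by rewrite iso; lra.
Qed.

Definition defect x : E := x - antishift x.

Lemma defect_linear : linear defect.
Proof. by move=> a x y; rewrite /defect linearP scalerBr opprD addrACA. Qed.

HB.instance Definition _ := GRing.isLinear.Build R E E *:%R defect defect_linear.

Lemma defect_half_antishift x :
  defect (half_antishift x) = 2^-1 *: (defect x + antishift (defect x)).
Proof. by rewrite linearZ linearD {2}/defect linearB. Qed.

Lemma sum_antishift x : \sum_i antishift x 0 i = \sum_i x 0 i - x 0 ord_max *+ 2.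
Proof.
rewrite big_ord_recl [in RHS]big_ord_recr /= antishift0 mulr2n.
rewrite opprD [RHS]addrA addrK [LHS]addrC; congr (_ - _).
by apply: eq_bigr => i _; rewrite antishift_lift.
Qed.

(* Describes [y0] plus the [j]-th Krylov space of [antishift], [s] being the
   coordinate sum of [defect y0]. *)
Definition krylov (s : R) (j : nat) z :=
  (forall i : 'I_K.+1, (j < i)%N -> defect z 0 i = 0) /\ \sum_i defect z 0 i = s.

Lemma krylovS s j z : krylov s j z -> krylov s j.+1 z.
Proof. by move=> [h hs]; split=> // i ji; apply: h; apply: ltnW. Qed.

(** One shift extends the support of the defect by one index. Since [j < K], the last coordinate of
    the defect is zero, so no sign flips and its sum survives. *)
Lemma krylov_half_antishift s j z : (j < K)%N -> krylov s j z ->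
  krylov s j.+1 (half_antishift z).
Proof.
move=> jK [h hs]; rewrite /krylov defect_half_antishift; split=> [i ji|].
  rewrite mxE mxE h ?(ltnW ji)// add0r.
  case: (unliftP ord0 i) ji => [k ->|-> //]; rewrite antishift_lift => jk.
  by rewrite h ?mulr0.
under eq_bigr => i _ do rewrite mxE mxE.
rewrite -mulr_sumr big_split /= sum_antishift h// mul0rn subr0 hs.
by field.
Qed.

(** Both conditions are affine in the point, so only the sum of the coefficients enters; this covers
    adaptive choices. *)
Lemma krylov_combination s j n (a : 'I_n -> R)
    (h : n.-tuple (euclidean_hilbert R K.+1)) :
  \sum_i a i = 1 -> (forall i, krylov s j (tnth h i)) ->
  krylov s j (combination a h).
Proof.
move=> a1 hk.
have dE i : defect (combination a h) 0 i = \sum_l a l * defect (tnth h l) 0 i.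
  rewrite /combination linear_sum summxE; apply: eq_bigr => l _.
  by rewrite linearZ mxE.
split=> [i ji|].
  by rewrite dE big1// => l _; rewrite (hk l).1// mulr0.
under eq_bigr do rewrite dE.
rewrite exchange_big /= -[RHS]mul1r -a1 mulr_suml; apply: eq_bigr => l _.
by rewrite -mulr_sumr (hk l).2.
Qed.

Definition resisting_operator :=
  @operator_of R (euclidean_hilbert R K.+1) half_antishift.
Definition resisting_start : E := const_mx (Num.sqrt K.+1%:R)^-1.

Lemma resolvent_resisting x : resolvent resisting_operator x = half_antishift x.
Proof. exact: resolvent_operator_of. Qed.

Lemma residual_resisting x :
  residual resisting_operator x = - (2^-1 *: defect x).
Proof.
rewrite /residual resolvent_resisting.
have {2}-> : x = 2^-1 *: (x + x).
  by rewrite -mulr2n -(scaler_nat 2 x) scalerA mulVf// scale1r.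
by rewrite -scalerBr -scalerN /defect opprB opprD addrACA subrr add0r.
Qed.

(** For a constant vector the differences cancel except at index 0, where the sign doubles the
    entry. *)
Lemma resisting_start_krylov : krylov ((Num.sqrt K.+1%:R)^-1 *+ 2) 0 resisting_start.
Proof.
have d j : defect resisting_start 0 (lift ord0 j) = 0.
  by rewrite /defect mxE [X in _ + X]mxE antishift_lift !mxE subrr.
split=> [i|].
  by case: (unliftP ord0 i) => [j ->|->].
rewrite big_ord_recl big1 ?addr0//.
by rewrite /defect mxE [X in _ + X]mxE antishift0 !mxE opprK mulr2n.
Qed.

(** Each evaluation raises the level by one; [k <= K] ensures that it is applied at a level below
    [K]. *)
Lemma resisting_history (m : method R) (k : nat) (i : 'I_k.+1) : (k <= K)%N ->
  krylov ((Num.sqrt K.+1%:R)^-1 *+ 2) k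
    (tnth (history m resisting_operator resisting_start k) i).
Proof.
elim: k i => [|k IH] i kK.
  rewrite ord1; exact: resisting_start_krylov.
rewrite (tnth_nth 0) /= nth_rcons size_tuple; case: ltnP => ik.
  by have := IH (Ordinal ik) (ltnW kK); rewrite (tnth_nth 0) => /krylovS.
have -> : (i == k.+1 :> nat) by rewrite eqn_leq ik -ltnS ltn_ord.
rewrite resolvent_resisting; apply: krylov_half_antishift => //.
apply: krylov_combination => [|l]; first exact: query_sum1.
exact: IH (ltnW kK).
Qed.

Lemma resisting_dist :
  dist (resisting_start : euclidean_hilbert R K.+1) (zeros resisting_operator) =
  1%:E.
Proof.
have -> : zeros resisting_operator = [set 0].
  rewrite zeros_operator_of; apply/seteqP; split=> x /= => [xE|->].
    (* A fixed point of [half_antishift] is one of [antishift]: double the equation and cancel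
       [x]. *)
    apply: antishift_fixed; apply: (addrI x).
    have := congr1 (fun t : E => 2 *: t) xE.
    by rewrite /half_antishift scalerA mulfV// scale1r => <-; rewrite scaler_nat mulr2n.
  by rewrite /half_antishift linear0 addr0 scaler0.
rewrite /dist image_set1 ereal_inf1 subr0; congr (_%:E).
rewrite -[LHS]/(euclid_norm resisting_start) /euclid_norm /euclid_dot.
under eq_bigr do rewrite !mxE -invfM -expr2 sqr_sqrtr//.
by rewrite sumr_const card_ord -[X in Num.sqrt X]mulr_natl mulfV ?sqrtr1 ?pnatr_eq0.
Qed.

Lemma resisting_residual (m : method R) :
  K.+1%:R^-1 <= `|residual resisting_operator
     (iterate m resisting_operator resisting_start K)|.
Proof.
set y := iterate _ _ _ _.
have [_ ys] : krylov ((Num.sqrt K.+1%:R)^-1 *+ 2) K y.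
  apply: krylov_combination; first exact: output_sum1.
  by move=> i; apply: resisting_history.
rewrite residual_resisting.
rewrite normrN normrZ ger0_norm// -(@ler_pXn2r _ 2) ?nnegrE ?mulr_ge0 ?invr_ge0//.
rewrite exprMn -euclid_dotxx.
(* Pairing with the all-ones vector gives the coordinate sum, which [krylov] fixes for every
   method. *)
have : euclid_dot (defect y) (const_mx 1) ^+ 2 <=
    euclid_dot (defect y) (defect y) * euclid_dot (const_mx 1 : E) (const_mx 1) :=
  dot_CauchySchwarz (@euclid_dot R K.+1) _ _.
have -> : euclid_dot (defect y) (const_mx 1) = (Num.sqrt K.+1%:R)^-1 *+ 2.
  by rewrite -ys; apply: eq_bigr => i _; rewrite [X in _ * X]mxE mulr1.
have -> : euclid_dot (const_mx 1 : E) (const_mx 1) = K.+1%:R.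
  rewrite /euclid_dot; under eq_bigr do rewrite !mxE mulr1.
  by rewrite sumr_const card_ord.
have n0 : 0 < K.+1%:R :> R by [].
have -> : ((Num.sqrt K.+1%:R)^-1 *+ 2) ^+ 2 = 4 * K.+1%:R^-1 :> R.
  by rewrite mulr2n -[in RHS](@sqr_sqrtr _ K.+1%:R) ?ler0n// -exprVn; ring.
have v0 : 0 < K.+1%:R^-1 :> R by rewrite invr_gt0.
move=> /(ler_wpM2r (ltW v0)); rewrite -[X in _ <= X]mulrA mulfV ?gt_eqF// mulr1.
by move: (K.+1%:R^-1) => v; lra.
Qed.
End LowerBound.

(** * The minimax value *)

Lemma worst_case_ge (R : realType) (K : nat) (m : method R) :
  ((K.+1%:R^-1)%:E <= worst_case K m)%E.
Proof.
have := resisting_residual K m; rewrite -lee_fin => /le_trans; apply.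
apply: ereal_sup_ubound.
exists (euclidean_hilbert R K.+1), (@resisting_operator R K), (resisting_start R K).
split=> //; last exact: resisting_dist.
exact/operator_of_maximal/half_antishift_fne.
Qed.

Lemma worst_case_halpern (R : realType) (K : nat) :
  (worst_case K (halpern R) <= (K.+1%:R^-1)%:E)%E.
Proof.
apply: ge_ereal_sup => _ [H [M [y0 [Mmax d1 ->]]]].
by rewrite lee_fin; exact: halpern_rate.
Qed.

Theorem corollary4p5 (R : realType) (K : nat) (hK : (1 <= K)%N) :
  minimax_value K (fun _ : method R => True) = ((K.+1%:R : R)^-1)%:E /\
  minimax_value K (@nonadaptive R) = ((K.+1%:R : R)^-1)%:E.
Proof.
(* The lower bound holds for every method, so any class containing [halpern] has the same value. *)
have minimaxE (C : method R -> Prop) : C (halpern R) ->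
    minimax_value K C = ((K.+1%:R : R)^-1)%:E.
  move=> Ch; apply/le_anti/andP; split.
    apply: le_trans (worst_case_halpern R K).
    by apply: ereal_inf_lbound; exists (halpern R).
  by apply: le_ereal_inf_tmp => _ [m [_ ->]]; exact: worst_case_ge.
by split; apply: minimaxE; last exact: halpern_nonadaptive.
Qed.
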